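(* Let $m \geq 1$ and $n \geq 1$ be integers. The map $$g: \mathbb{U}_m \wr \mathfrak{S}_n \rightarrow \langle\mathsf{G}, \mathsf{g}\rangle_{n-1}, \qquad \pi \mapsto \sum_{i=1}^{n} \mathtt{pinv}_i(\pi)\, \mathsf{G}_{n-i},$$ is bijective.
   Context: $\mathfrak{S}_n$ is the symmetric group on $[n]=\{1,\dots,n\}$, $\mathbb{U}_m$ is the group of $m$-th roots of unity, and $\mathbb{U}_m \wr \mathfrak{S}_n$ is their wreath product (the colored permutation group of $m$ colors and $n$ elements). An element $\pi \in \mathbb{U}_m \wr \mathfrak{S}_n$ is represented as $\pi = \begin{pmatrix} 1 & 2 & \dots & n\\ \zeta_{k_1}\sigma(1) & \zeta_{k_2}\sigma(2) & \dots & \zeta_{k_n}\sigma(n)\end{pmatrix}$ with $\sigma \in \mathfrak{S}_n$, $\zeta_{k_j} = e^{2\pi \sqrt{-1}\, k_j/m}$ and $k_j \in \{0,1,\dots,m-1\}$; thus $\pi$ amounts to a pair consisting of $\sigma\in\mathfrak{S}_n$ and $(k_1,\dots,k_n)\in\{0,\dots,m-1\}^n$. For $i \in [n]$, the number of $i$-pseudoinversions of $\pi$ is $$\mathtt{pinv}_i\,\pi := k_i(n-i+1) + \big|\{j \in \{i+1,\dots,n\} \mid \sigma(i) > \sigma(j)\}\big|.$$ For $i \in \mathbb{N}=\{0,1,2,\dots\}$ put $\mathsf{G}_i = m^i\, i!$ and $\mathsf{g}_i = m(i+1)-1$. For $k \in \mathbb{N}$, put $$\langle\mathsf{G}, \mathsf{g}\rangle_k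 := \Big\{\sum_{i=0}^k \gamma_i \mathsf{G}_i \ \Big|\ \gamma_i \in \{0,1,\dots,\mathsf{g}_i\} \text{ for } 0\le i\le k\Big\}.$$ *)

(* Defs.v *)
From mathcomp Require Import all_boot all_fingroup.
From mathcomp Require Import classical_sets functions.

Set Implicit Arguments.
Unset Strict Implicit.
Unset Printing Implicit Defensive.

Local Open Scope nat_scope.

(* An element of U_m wr S_n, in window notation
   (zeta_{k_1} sigma(1), ..., zeta_{k_n} sigma(n)) with
   zeta_k = exp(2 i pi k / m) and 0 <= k < m, is recorded as the pair
   (sigma, (k_1, ..., k_n)). Positions and values are shifted to 0..n-1. *)
Definition colored_perm (m n : nat) : finType :=
  ('S_n * {ffun 'I_n -> 'I_m})%type.

Definition cperm m n (p : colored_perm m n) : 'S_n := p.1.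

Definition color m n (p : colored_perm m n) (i : 'I_n) : 'I_m := p.2 i.

(* The ordinal i stands for the position i + 1, so that n - i below is the
   factor n - (i + 1) + 1. *)
Definition pinv m n (p : colored_perm m n) (i : 'I_n) : nat :=
  color p i * (n - i) +
  #|[set j : 'I_n | (i < j) && (cperm p j < cperm p i)]|.

Definition G_ (m i : nat) : nat := m ^ i * i`!.

Definition g_ (m i : nat) : nat := m * i.+1 - 1.

Definition Gg_span (m k : nat) : set nat :=
  [set x | exists gamma : nat -> nat,
     (forall i, i <= k -> gamma i <= g_ m i) /\
     x = \sum_(0 <= i < k.+1) gamma i * G_ m i]%classic.

Definition pinv_code m n (p : colored_perm m n) : nat :=
  \sum_(i < n) pinv p i * G_ m (n - i.+1).

(* Main.v *)
Require Import Defs.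
From mathcomp Require Import all_boot all_fingroup.
From mathcomp Require Import classical_sets functions.

(** The weights satisfy [G_(i+1) = m (i+1) G_i] and the digit of [G_i] ranges
    below [m (i+1)], so this is a mixed radix system: digit expansions of length
    [n] are unique and lie below [G_n = m^n n!]. The digit [pinv_i] determines
    the color [k_i] (quotient by [n-i+1]) and the Lehmer code of the permutation
    (remainder), so the map is injective; since [m^n n!] is also the order of
    the wreath product, it hits every number below [G_n]. *)

Lemma G_S m i : G_ m i.+1 = m * i.+1 * G_ m i.
Proof. by rewrite /G_ expnS factS mulnACA. Qed.

Lemma G_gt0 m i : 0 < m -> 0 < G_ m i.
Proof. by move=> m_gt0; rewrite muln_gt0 expn_gt0 m_gt0 fact_gt0. Qed.

Lemma leq_g m i d : 0 < m -> (d <= g_ m i) = (d < m * i.+1).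
Proof. by move=> m_gt0; rewrite /g_ subn1 -ltnS prednK // muln_gt0 m_gt0. Qed.

(** By induction the lower digits contribute less than one unit of the top weight, so the sum stays
    below [(d n).+1 * G_ m n], which is at most [G_ m n.+1]. *)
Lemma radix_sum_lt m n (d : nat -> nat) :
    (forall i, i < n -> d i < m * i.+1) ->
  \sum_(0 <= i < n) d i * G_ m i < G_ m n.
Proof.
elim: n => [|n IHn] d_lt; first by rewrite big_geq.
rewrite big_nat_recr //= G_S.
have lt_n : \sum_(0 <= i < n) d i * G_ m i < G_ m n.
  by apply: IHn => i lt_in; apply/d_lt/ltnW.
apply: (@leq_trans ((d n).+1 * G_ m n)); last by rewrite leq_mul2r d_lt ?orbT.
by rewrite mulSn ltn_add2r.
Qed.

(** The lower part being smaller than [G_ m n], the top digit is the quotient by [G_ m n];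
    cancelling it leaves the induction hypothesis. *)
Lemma radix_sum_inj m n (d e : nat -> nat) :
    (forall i, i < n -> d i < m * i.+1) ->
    (forall i, i < n -> e i < m * i.+1) ->
    \sum_(0 <= i < n) d i * G_ m i = \sum_(0 <= i < n) e i * G_ m i ->
  forall i, i < n -> d i = e i.
Proof.
elim: n => // n IHn d_lt e_lt; rewrite !big_nat_recr //= => eq_de.
have lt_d : forall i, i < n -> d i < m * i.+1 by move=> i /ltnW/d_lt.
have lt_e : forall i, i < n -> e i < m * i.+1 by move=> i /ltnW/e_lt.
have sum_d := radix_sum_lt _ _ _ lt_d; have sum_e := radix_sum_lt _ _ _ lt_e.
have G0 : 0 < G_ m n by apply: leq_ltn_trans sum_d.
have eq_n : d n = e n.
  have := congr1 (divn^~ (G_ m n)) eq_de.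
  by rewrite /= !divnDMl // !divn_small.
move=> i; rewrite ltnS leq_eqVlt => /predU1P[-> //|].
by apply: IHn => //; move: eq_de; rewrite eq_n => /addIn.
Qed.

Definition lehmer {n} (s : 'S_n) (i : 'I_n) : nat :=
  #|[set j : 'I_n | (i < j) && (s j < s i)]|.

(** The counted positions lie among the [n - i] positions from [i] on, and [i] itself is never
    counted. *)
Lemma lehmer_lt n (s : 'S_n) (i : 'I_n) : lehmer s i < n - i.
Proof.
have <- : #|[set j : 'I_n | i <= j]| = n - i.
  by rewrite -sum1dep_card -(big_geq_mkord i n predT (fun=> 1)) sum_nat_const_nat muln1.
apply/proper_card/properP; split.
  by apply/fintype.subsetP=> j; rewrite !inE => /andP[/ltnW].
by exists i; rewrite !inE ?ltnn.
Qed.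

(* If [s] and [t] agree before [i], the values still available at [i] are the
   same for both, and the Lehmer digit is the rank of the value chosen. *)
Lemma lehmer_mono n (s t : 'S_n) (i : 'I_n) :
    (forall j : 'I_n, j < i -> s j = t j) -> s i < t i ->
  lehmer s i < lehmer t i.
Proof.
move=> eq_st lt_st.
(* Taking images replaces the counted positions by their values, so that the two sets can be
   compared by inclusion. *)
rewrite -[lehmer s i](card_imset _ (@perm_inj _ s)).
rewrite -[lehmer t i](card_imset _ (@perm_inj _ t)).
have later (x : 'I_n) : x < t i -> ~~ ((s^-1)%g x < i) -> i < (t^-1)%g x.
  move=> x_lt; apply: contraR; rewrite -leqNgt leq_eqVlt.
  case/predU1P=> [/val_inj eq_i|lt_i].
    by move: x_lt; rewrite -eq_i permKV ltnn.
  by rewrite -[x in (s^-1)%g x](permKV t) -eq_st ?permK.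
apply/proper_card/properP; split.
  apply/fintype.subsetP=> x /imsetP[j]; rewrite inE => /andP[lt_ij lt_s] ->{x}.
  have lt_t := ltn_trans lt_s lt_st.
  apply/imsetP; exists ((t^-1)%g (s j)); rewrite ?permKV // inE permKV lt_t andbT.
  by apply: later => //; rewrite permK -leqNgt ltnW.
(* The inclusion is strict: [s i] is counted for [t], but it is not below itself. *)
exists (s i).
  apply/imsetP; exists ((t^-1)%g (s i)); rewrite ?permKV // inE permKV lt_st andbT.
  by apply: later => //; rewrite permK ltnn.
by apply/imsetP=> -[j]; rewrite inE => /andP[_ +] eq_j; rewrite eq_j ltnn.
Qed.

Lemma lehmer_inj n (s t : 'S_n) : lehmer s =1 lehmer t -> s = t.
Proof.
move=> eq_l; apply/permP => i.
have [k] := ubnP (val i); elim: k i => // k IHk i; rewrite ltnS => le_ik.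
have eq_st (j : 'I_n) : j < i -> s j = t j.
  by move=> lt_ji; apply: IHk; apply: leq_trans le_ik.
apply: val_inj; case: (ltngtP (s i) (t i)) => // [lt_st|lt_ts].
  by have := lehmer_mono _ _ _ _ eq_st lt_st; rewrite eq_l ltnn.
have eq_ts (j : 'I_n) : j < i -> t j = s j by move=> /eq_st.
by have := lehmer_mono _ _ _ _ eq_ts lt_ts; rewrite eq_l ltnn.
Qed.

Lemma pinvE m n (p : colored_perm m n) i :
  Defs.pinv p i = color p i * (n - i) + lehmer (cperm p) i.
Proof. by []. Qed.

Lemma pinv_lt m n (p : colored_perm m n) i : Defs.pinv p i < m * (n - i).
Proof.
apply: (@leq_trans ((color p i).+1 * (n - i))); last by rewrite leq_mul2r ltn_ord orbT.
by rewrite pinvE mulSn addnC ltn_add2r lehmer_lt.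
Qed.

Lemma pinv_inj m n (p q : colored_perm m n) : Defs.pinv p =1 Defs.pinv q -> p = q.
Proof.
move=> eq_pq.
have eq_ck i : color p i = color q i /\ lehmer (cperm p) i = lehmer (cperm q) i.
  have n_gt0 : 0 < n - i by rewrite subn_gt0.
  have := eq_pq i; rewrite !pinvE => eq_i; split.
    apply: val_inj; have := congr1 (divn^~ (n - i)) eq_i.
    by rewrite /= !divnMDl // !divn_small ?lehmer_lt ?addn0.
  have := congr1 (modn^~ (n - i)) eq_i.
  by rewrite /= !modnMDl !modn_small ?lehmer_lt.
case: p q eq_ck {eq_pq} => [s k] [t l] eq_ck; congr (_, _).
  by apply: lehmer_inj => i; case: (eq_ck i).
by apply/ffunP => i; case: (eq_ck i).
Qed.

(** Positions are reversed, so that digit [i] goes with the weight [G_ m i]. The index is a natural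
    number, as in [Gg_span]; [inord] is faithful here because [n - i <= n]. *)
Definition pinv_digit {m n} (p : colored_perm m n.+1) (i : nat) : nat :=
  Defs.pinv p (inord (n - i)).

Lemma pinv_digit_lt m n (p : colored_perm m n.+1) i :
  i < n.+1 -> pinv_digit p i < m * i.+1.
Proof.
rewrite ltnS => le_in; have := pinv_lt _ _ p (inord (n - i)).
by rewrite inordK ?ltnS ?leq_subr // subSn ?leq_subr // subKn.
Qed.

Lemma pinv_code_digits m n (p : colored_perm m n.+1) :
  pinv_code p = \sum_(0 <= i < n.+1) pinv_digit p i * G_ m i.
Proof.
rewrite big_nat_rev big_mkord; apply: eq_bigr => i _.
by rewrite add0n subSS /pinv_digit subKn -1?ltnS ?inord_val.
Qed.

Lemma pinv_code_inj m n : injective (@pinv_code m n.+1).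
Proof.
move=> p q; rewrite !pinv_code_digits => eq_pq; apply: pinv_inj => i.
have le_in : i <= n by rewrite -ltnS.
have := radix_sum_inj _ _ _ _ (pinv_digit_lt _ _ p) (pinv_digit_lt _ _ q) eq_pq (n - i).
by rewrite /pinv_digit subKn // inord_val; apply; rewrite ltnS leq_subr.
Qed.

Lemma pinv_code_lt m n (p : colored_perm m n.+1) : pinv_code p < G_ m n.+1.
Proof. by rewrite pinv_code_digits; apply: radix_sum_lt; apply: pinv_digit_lt. Qed.

Lemma card_colored_perm m n : #|colored_perm m n| = G_ m n.
Proof. by rewrite card_prod card_Sn card_ffun !card_ord mulnC. Qed.

Lemma pinv_code_onto m n x :
  x < G_ m n.+1 -> exists p : colored_perm m n.+1, pinv_code p = x.
Proof.
(* With its codomain cut down to the ordinals below [G_ m n.+1], the code is an injection between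
   finite types of equal cardinality. *)
move=> x_lt; pose f p := Ordinal (@pinv_code_lt m n p).
have f_inj : injective f by move=> p q /(congr1 val)/pinv_code_inj.
have /codomP[p /(congr1 val)/= ->] : Ordinal x_lt \in codom f.
  by apply: inj_card_onto => //; rewrite card_ord card_colored_perm.
by exists p.
Qed.

Theorem theorem1p6 (m n : nat) (hm : 1 <= m) (hn : 1 <= n) :
  set_bij [set: colored_perm m n]%classic (Gg_span m (n - 1))
    (@pinv_code m n).
Proof.
case: n hn => // n _; rewrite subn1 /=; split.
- move=> p _; exists (pinv_digit p); split; last exact: pinv_code_digits.
  by move=> i le_in; rewrite leq_g //; apply: pinv_digit_lt.
- by move=> p q _ _; apply: pinv_code_inj.
- move=> x [d [d_le ->]].
  have [|p <-] := pinv_code_onto m n (\sum_(0 <= i < n.+1) d i * G_ m i); last by exists p.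
  by apply: radix_sum_lt => i lt_in; rewrite -leq_g //; apply: d_le.
Qed.
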